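(* Let $E$ be a real Banach space, let $I_0, I$ be finite disjoint index sets with $I_0\cup I=\{1,\dots,n\}$ (either one may be empty), let $h_0,h_1,\dots,h_n:E\to\mathbb{R}$, and let $$\mathcal F:=\{x\in E \mid h_i(x)=0,\ i\in I_0,\ h_i(x)\le 0,\ i\in I\}.$$ Let $x_0\in\mathcal F$ be a local minimum of the problem of minimizing $h_0(x)$ subject to $x\in\mathcal F$, suppose that $h_0$ and all $h_i$, $i\in I_0\cup I$, are of class $C^1$ in a neighbourhood of $x_0$, and let the relaxed constant rank constraint qualification (RCRCQ) hold for $\mathcal F$ at $x_0$. Then the set of Lagrange multipliers at $x_0$ is nonempty: $\Lambda(x_0)\neq\emptyset$.
   Context: $Dh_i(x)\in E^*$ is the Fréchet derivative. The rank of a finite family of vectors is the cardinality of a maximal linearly independent subfamily. Active index set: $I(x_0):=\{i\in I\mid h_i(x_0)=0\}$. RCRCQ holds for $\mathcal F$ at $x_0\in\mathcal F$ if there is a neighbourhood $U(x_0)$ such that for every index set $J$ with $I_0\subset J\subset I_0\cup I(x_0)$, $\operatorname{rank}\{Dh_i(x),\ i\in J\}=\operatorname{rank}\{Dh_i(x_0),\ i\in J\}$ for all $x\in U(x_0)$. Lagrangian: $L(\lambda,x):=h_0(x)+\sum_{i=1}^n\lambda_i h_i(x)$, $\lambda=(\lambda_1,\dots,\lambda_n)\in\mathbb{R}^n$. Set of Lagrange multipliers at $x\in\mathcal F$: $$\Lambda(x):=\{\lambda\in\mathbb{R}^n\mid D_xL(\lambda,x)=0,\ \lambda_i\ge 0\text{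 and }\lambda_i h_i(x)=0,\ i\in I\}.$$ *)

(* Defs.v *)
From HB Require Import structures.
From mathcomp Require Import all_boot all_order all_algebra.
From mathcomp Require Import all_classical all_reals all_analysis.

Set Implicit Arguments.
Unset Strict Implicit.
Unset Printing Implicit Defensive.
Import Order.TTheory GRing.Theory Num.Theory.
Import numFieldNormedType.Exports.

Local Open Scope classical_set_scope.
Local Open Scope ring_scope.

Definition lin_indep (R : fieldType) (V : lmodType R) (n : nat)
    (v : 'I_n -> V) (K : {set 'I_n}) : Prop :=
  forall c : 'I_n -> R,
    \sum_(i in K) c i *: v i = 0 -> forall i, i \in K -> c i = 0.

(* Independence is that of an indexed family: if v i = v j with i <> j, then
   no independent subfamily contains both indices. *)
Definition family_rank (R : fieldType) (V : lmodType R) (n : nat)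
    (v : 'I_n -> V) (J : {set 'I_n}) : nat :=
  \max_(K : {set 'I_n} | (K \subset J) && `[< lin_indep v K >]) #|K|.

(* f is Frechet differentiable around x0 and its derivative is continuous
   there for the operator norm of the dual of E: the last inequality says that
   the operator norm of 'd f y - 'd f x is at most e. *)
Definition C1_near (R : realType) (E : normedModType R) (f : E -> R)
    (x0 : E) : Prop :=
  \forall x \near x0, differentiable f x /\
    forall e : R, 0 < e ->
      \forall y \near x, forall v : E,
        `|'d f y v - 'd f x v| <= e * `|v|.

(* The constraint index set {1, ..., n} is represented by 'I_n; the objective
   h0 is kept apart from the family h of constraint functions. *)
Definition feasible (R : realType) (E : normedModType R) (n : nat)
    (I0 I : {set 'I_n}) (h : 'I_n -> E -> R) : set E :=
  [set x | (forall i, i \in I0 -> h i x = 0) /\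
           (forall i, i \in I -> h i x <= 0)].

Definition local_minimum (R : realType) (E : normedModType R) (h0 : E -> R)
    (F : set E) (x0 : E) : Prop :=
  F x0 /\ \forall x \near x0, F x -> h0 x0 <= h0 x.

Definition active (R : realType) (E : normedModType R) (n : nat)
    (I : {set 'I_n}) (h : 'I_n -> E -> R) (x : E) : {set 'I_n} :=
  [set i in I | h i x == 0]%SET.

(* The derivatives are viewed in the vector space of functions E -> R, which
   contains the dual of E as a subspace; the rank is the same in both. *)
Definition diff_rank (R : realType) (E : normedModType R) (n : nat)
    (h : 'I_n -> E -> R) (J : {set 'I_n}) (x : E) : nat :=
  family_rank (fun i => 'd (h i) x : E -> R^o) J.

Definition RCRCQ (R : realType) (E : normedModType R) (n : nat)
    (I0 I : {set 'I_n}) (h : 'I_n -> E -> R) (x0 : E) : Prop :=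
  exists2 U : set E, nbhs x0 U &
    forall J : {set 'I_n}, I0 \subset J -> J \subset I0 :|: active I h x0 ->
      forall x, U x -> diff_rank h J x = diff_rank h J x0.

Definition lagrangian (R : realType) (E : normedModType R) (n : nat)
    (h0 : E -> R) (h : 'I_n -> E -> R) (lambda : 'rV[R]_n) (x : E) : R :=
  h0 x + \sum_(i < n) lambda ord0 i * h i x.

(* [is_diff x f df] includes differentiability of f at x, which the total
   function 'd alone would not guarantee. *)
Definition multipliers (R : realType) (E : normedModType R) (n : nat)
    (I : {set 'I_n}) (h0 : E -> R) (h : 'I_n -> E -> R) (x : E) :
    set 'rV[R]_n :=
  [set lambda | is_diff x (lagrangian h0 h lambda) (0 : E -> R) /\
     (forall i, i \in I -> 0 <= lambda ord0 i /\ lambda ord0 i * h i x = 0)].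

(* Main.v *)
Require Import Defs.
From mathcomp Require Import all_boot all_order all_algebra.
From mathcomp Require Import all_classical all_reals all_analysis.
From mathcomp Require Import ring lra.
Import Order.TTheory GRing.Theory Num.Theory.
Import numFieldNormedType.Exports.
Local Open Scope classical_set_scope.
Local Open Scope ring_scope.

(* Finitely many directions e_l in E already detect every linear relation
   between the derivatives of h_0, ..., h_n at x_0. On the affine slice
   x_0 + span(e_l) the ranks of the derivatives are still locally constant: they
   are lower semicontinuous, bounded by the ranks in the dual of E, and equal to
   these at x_0. A multiplier for the restricted problem is then a multiplier
   for the original one, so that neither an implicit function theorem nor
   completeness of E is needed.

   In finite dimension, minimizing a quadratic penalty on a small ball yields
   points s -> 0 with G_0(s) + s + l(s) G(s) = 0, where G_0 and G collect the
   gradients and l(s) has the required signs. Let B index a basis of the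
   equality gradients at 0, hence at all nearby s by constancy of the rank.
   Caratheodory's lemma makes the support of l(s) a set B + K independent at s,
   and constancy of the rank of the gradients indexed by I_0 + K makes it
   independent at 0 as well. For a value of K that recurs as s -> 0, l(s)
   therefore converges, and its limit is a multiplier. *)

Set Implicit Arguments.
Unset Strict Implicit.

(** * Ranks of row selections *)

Section RowMask.
Variables (F : fieldType) (n : nat).
Implicit Types (J K : {set 'I_n}).

(** Rows are selected by a diagonal 0/1 matrix, so that selections for different index sets keep the
    same format and their row spaces compare without reindexing. *)
Definition rowmask J : 'M[F]_n := diag_mx (\row_i (i \in J)%:R).

Lemma rowmaskE m J (G : 'M[F]_(n, m)) i j :
  (rowmask J *m G) i j = (i \in J)%:R * G i j.
Proof. by rewrite mul_diag_mx !mxE. Qed.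

Lemma mulmx_rowmaskE (u : 'rV[F]_n) J i :
  (u *m rowmask J) 0 i = (i \in J)%:R * u 0 i.
Proof. by rewrite mul_mx_diag !mxE mulrC. Qed.

Lemma row_rowmask m J (G : 'M[F]_(n, m)) i :
  row i (rowmask J *m G) = (i \in J)%:R *: row i G.
Proof. by apply/rowP => j; rewrite mxE rowmaskE !mxE. Qed.

Lemma tr_rowmask J : (rowmask J)^T = rowmask J.
Proof. exact: tr_diag_mx. Qed.

Lemma sub_rowmaskP m p J (G : 'M[F]_(n, m)) (M : 'M[F]_(p, m)) :
  reflect (forall i, i \in J -> (row i G <= M)%MS) (rowmask J *m G <= M)%MS.
Proof.
apply: (iffP row_subP) => [GM i iJ|GM i].
  by have := GM i; rewrite row_rowmask iJ scale1r.
rewrite row_rowmask; have [iJ|iJ] := boolP (i \in J); last by rewrite scale0r sub0mx.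
by rewrite scale1r GM.
Qed.

Lemma rowmaskS m J K (G : 'M[F]_(n, m)) :
  J \subset K -> (rowmask J *m G <= rowmask K *m G)%MS.
Proof.
move=> /fintype.subsetP JK; apply/sub_rowmaskP => i /JK iK.
by have := row_sub i (rowmask K *m G); rewrite row_rowmask iK scale1r.
Qed.

Lemma row_sub_rowmask m K (G : 'M[F]_(n, m)) i :
  i \in K -> (row i G <= rowmask K *m G)%MS.
Proof. by move=> iK; have /sub_rowmaskP := submx_refl (rowmask K *m G); apply. Qed.

Lemma rank_rowmask_le m J (G : 'M[F]_(n, m)) :
  (\rank (rowmask J *m G) <= #|J|)%N.
Proof.
have sub : (rowmask J *m G <= \sum_(i in J) <<row i G>>)%MS.
  by apply/sub_rowmaskP => i iJ; rewrite (sumsmx_sup i)// genmxE.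
apply: leq_trans (mxrankS sub) _; apply: leq_trans (mxrank_sum_leqif _) _.
rewrite /= -sum1_card leq_sum// => i _.
by rewrite genmxE rank_rV leq_b1.
Qed.

(** The masks of [J] and of its complement together span the whole space, so neither of the two
    upper bounds on their ranks can be strict. *)
Lemma rank_rowmask J : \rank (rowmask J) = #|J|.
Proof.
have le K : (\rank (rowmask K) <= #|K|)%N.
  by rewrite -[rowmask K]mulmx1 rank_rowmask_le.
apply/eqP; rewrite eqn_leq le/=.
rewrite -(leq_add2r #|~: J|) cardsC card_ord.
have sub : ((1%:M : 'M[F]_n) <= rowmask J + rowmask (~: J))%MS.
  apply/row_subP => i; case: (boolP (i \in J)) => iJ.
    apply: submx_trans (addsmxSl _ _); rewrite -[rowmask J]mulmx1.
    exact: row_sub_rowmask.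
  apply: submx_trans (addsmxSr _ _); rewrite -[rowmask _]mulmx1.
  by apply: row_sub_rowmask; rewrite inE.
have := mxrankS sub; rewrite mxrank1 => /leq_trans; apply.
by apply: leq_trans (mxrank_adds_leqif _ _) _; rewrite leq_add2l le.
Qed.

(** Both sides say that [kermx G] meets the row space of [rowmask J], the vectors supported in [J],
    only in 0. *)
Lemma rowmask_freeP m J (G : 'M[F]_(n, m)) :
  reflect (forall u : 'rV[F]_n, u *m rowmask J *m G = 0 -> u *m rowmask J = 0)
    (\rank (rowmask J *m G) == #|J|).
Proof.
rewrite -(rank_rowmask J); apply: (iffP eqP) => [/mxrank_injP/eqP cap u uG|inj].
  apply/eqP; rewrite -submx0 -cap sub_capmx submxMl/=.
  exact/sub_kermxP.
apply/mxrank_injP; rewrite -submx0; apply/row_subP => i.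
have : (row i (rowmask J :&: kermx G) <= rowmask J)%MS.
  by rewrite (submx_trans (row_sub _ _))// capmxSl.
have : (row i (rowmask J :&: kermx G) <= kermx G)%MS.
  by rewrite (submx_trans (row_sub _ _))// capmxSr.
by move=> /sub_kermxP uG /submxP[u uE]; rewrite uE inj ?sub0mx// -uE.
Qed.

Lemma mulmx_rowmask_id (u : 'rV[F]_n) J :
  (forall i, i \notin J -> u 0 i = 0) -> u *m rowmask J = u.
Proof.
move=> u0; apply/rowP => i; rewrite mulmx_rowmaskE.
by have [|/u0 ->] := boolP (i \in J); rewrite ?mul1r ?mulr0.
Qed.

(** [K] is a largest independent subset of [J]: a row of [J] outside its span could be added to
    it. *)
Lemma rowmask_basis m J (G : 'M[F]_(n, m)) :
  exists K : {set 'I_n}, [/\ K \subset J, \rank (rowmask K *m G) = #|K| &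
    (rowmask J *m G <= rowmask K *m G)%MS].
Proof.
pose P K := (K \subset J) && (\rank (rowmask K *m G) == #|K|).
have P0 : P finset.set0.
  rewrite /P finset.sub0set cards0 -leqn0 -[X in (_ <= X)%N](cards0 'I_n).
  exact: rank_rowmask_le.
case: (arg_maxnP (fun K : {set 'I_n} => #|K|) P0) => K /andP[KJ /eqP rK] Kmax.
exists K; split=> //; apply/sub_rowmaskP => j jJ.
apply: contraT => jK.
have jNK : j \notin K by apply: contra jK => /row_sub_rowmask.
suff /Kmax : P (j |: K) by rewrite /= cardsU1 jNK add1n ltnn.
rewrite /P finset.subUset finset.sub1set jJ KJ/= eqn_leq rank_rowmask_le.
rewrite cardsU1 jNK add1n.
rewrite -rK ltn_neqAle mxrankS ?rowmaskS ?finset.subsetUr// andbT.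
have := @mxrank_leqif_eq _ _ _ _ _ _ (rowmaskS G (finset.subsetUr [set j]%SET K)).
move=> [_ ->]; apply: contra jK => /andP[_ /(submx_trans _)]; apply.
by apply: row_sub_rowmask; rewrite !inE eqxx.
Qed.

(** After transposition, [G^T *m rowmask J] has its row space inside that of [rowmask J] and the
    same rank, hence the same row space. The matrix [B] recovers coefficients supported in [J] from
    the combination of rows that they define. *)
Lemma rowmask_right_inverse m J (G : 'M[F]_(n, m)) :
  \rank (rowmask J *m G) = #|J| ->
  exists B : 'M[F]_(m, n), rowmask J *m G *m B = rowmask J.
Proof.
move=> rG.
have sub : (G^T *m rowmask J <= rowmask J)%MS by rewrite submxMl.
have [_] := mxrank_leqif_eq sub.
rewrite -{1}(tr_rowmask J) -trmx_mul mxrank_tr rG rank_rowmask eqxx.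
move=> /esym/andP[_ /submxP[X XE]]; exists X^T.
by apply: trmx_inj; rewrite trmx_mul trmxK trmx_mul !tr_rowmask -XE.
Qed.

Lemma rowmaskU_sub m p J K (G : 'M[F]_(n, m)) (M : 'M[F]_(p, m)) :
  (rowmask (J :|: K) *m G <= M)%MS =
  (rowmask J *m G <= M)%MS && (rowmask K *m G <= M)%MS.
Proof.
apply/idP/andP => [/sub_rowmaskP JK|[/sub_rowmaskP JM /sub_rowmaskP KM]].
  by split; apply/sub_rowmaskP => i iJ; apply: JK; rewrite inE iJ ?orbT.
by apply/sub_rowmaskP => i; rewrite inE => /orP[/JM|/KM].
Qed.

(** Constancy of the rank concerns index sets containing [J], whereas independence can only be
    expected of [B :|: K]; this equality passes from one to the other. *)
Lemma rank_rowmaskU m (B J K : {set 'I_n}) (G : 'M[F]_(n, m)) :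
  B \subset J -> (rowmask J *m G <= rowmask B *m G)%MS ->
  \rank (rowmask (B :|: K) *m G) = \rank (rowmask (J :|: K) *m G).
Proof.
move=> BJ JB; apply: eqmx_rank; apply/andP; split.
  by apply: rowmaskS; rewrite finset.setSU.
rewrite rowmaskU_sub; apply/andP; split; last exact/rowmaskS/finset.subsetUr.
by apply: submx_trans JB _; apply/rowmaskS/finset.subsetUl.
Qed.

End RowMask.
Arguments rowmask {F n}.

(* Among the representations of [l *m G] with the required signs, one using a
   minimal part [K] of [A] is independent: otherwise a multiple of a linear
   relation could be subtracted so as to annihilate one more coefficient. *)
Lemma conic_caratheodory (F : realFieldType) n m (G : 'M[F]_(n, m))
    (J B A : {set 'I_n}) (l : 'rV[F]_n) :
  [disjoint J & A]%B -> B \subset J -> (rowmask J *m G <= rowmask B *m G)%MS ->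
  \rank (rowmask B *m G) = #|B| ->
  (forall i, i \notin J :|: A -> l 0 i = 0) ->
  (forall i, i \in A -> 0 <= l 0 i) ->
  exists (K : {set 'I_n}) (u : 'rV[F]_n),
    [/\ K \subset A, \rank (rowmask (B :|: K) *m G) = #|B :|: K|,
        u *m G = l *m G, (forall i, i \notin B :|: K -> u 0 i = 0) &
        (forall i, i \in A -> 0 <= u 0 i)].
Proof.
move=> dJA BJ JB rB l0 lA.
have dBA i : i \in A -> i \notin B.
  by move=> iA; apply: contraL iA => /(fintype.subsetP BJ)/(disjointFr dJA) ->.
pose Q (K : {set 'I_n}) (u : 'rV[F]_n) := [/\ u *m G = l *m G,
  (forall i, i \notin B :|: K -> u 0 i = 0) & (forall i, i \in A -> 0 <= u 0 i)].
pose P (K : {set 'I_n}) := (K \subset A) && `[<exists u, Q K u>].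
(* All of [A] is admissible once the part of [l] on [J] is rewritten over the basis [B]. *)
have PA : P A.
  rewrite /P subxx; apply/asboolP.
  have : (l *m rowmask J *m G <= rowmask B *m G)%MS.
    by rewrite -mulmxA (submx_trans (submxMl _ _)).
  move=> /submxP[v vE]; exists (v *m rowmask B + l *m rowmask A); split.
  - rewrite mulmxDl -(mulmxA v) -vE -mulmxDl; congr (_ *m _).
    apply/rowP => i; rewrite mxE !mulmx_rowmaskE.
    have := l0 i; rewrite inE negb_or.
    case: (boolP (i \in J)) => iJ; case: (boolP (i \in A)) => iA /=.
    + by have := disjointFr dJA iJ; rewrite iA.
    + by rewrite mul1r mul0r addr0.
    + by rewrite mul1r mul0r add0r.
    + by move=> ->//; rewrite !mulr0 addr0.
  - by move=> i; rewrite inE mxE !mulmx_rowmaskE => /norP[/negbTE -> /negbTE ->];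
      rewrite !mul0r addr0.
  - move=> i iA; rewrite mxE !mulmx_rowmaskE (negbTE (dBA i iA)) mul0r add0r.
    by rewrite iA mul1r lA.
case: (arg_minnP (fun K : {set 'I_n} => #|K|) PA) => K /andP[KA /asboolP[u Qu]].
move=> Kmin; exists K, u; case: Qu => uG u0 uA; split=> //.
apply/eqP/rowmask_freeP => c0 c0G.
set c := c0 *m _ in c0G *.
have supp_c i : i \notin B :|: K -> c 0 i = 0.
  by move=> /negbTE iBK; rewrite mulmx_rowmaskE iBK mul0r.
(* Applied to [c] and to [- c], this makes [c] vanish on [K]; then [c] is a relation between the
   rows of [B], which are independent. *)
suff noK (d : 'rV[F]_n) : d *m G = 0 -> (forall i, i \notin B :|: K -> d 0 i = 0) ->
    forall i, i \in K -> d 0 i <= 0.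
  have cK i : i \in K -> c 0 i = 0.
    move=> iK; apply/eqP; rewrite eq_le noK//=.
    have := noK (- c); rewrite mulNmx c0G oppr0 => /(_ erefl) noK'.
    have := noK' _ i iK; rewrite mxE oppr_le0; apply => j jBK.
    by rewrite mxE supp_c ?oppr0.
  have cB : c *m rowmask B = c.
    apply: mulmx_rowmask_id => i iB; have [/cK//|iK] := boolP (i \in K).
    by apply: supp_c; rewrite inE negb_or iB.
  by rewrite -cB; move/eqP/rowmask_freeP: rB; apply; rewrite cB.
move=> dG supp_d i iK; rewrite leNgt; apply/negP => di.
(* Ratio test: the least [u 0 j / d 0 j] over positive [d 0 j] is the largest multiple of [d] that
   can be subtracted while [u] stays nonnegative on [A]. It annihilates the coefficient at [k],
   against the minimality of [K]. *)
pose R0 j := (j \in K) && (0 < d 0 j).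
have Ri : R0 i by rewrite /R0 iK.
case: (Order.TotalTheory.arg_minP (fun j => u 0 j / d 0 j) Ri) => k /andP[kK dk] kmin.
pose t := u 0 k / d 0 k.
have t0 : 0 <= t by apply: divr_ge0; [exact/uA/(fintype.subsetP KA)|exact: ltW].
have /Kmin : P (K :\ k).
  rewrite /P (fintype.subset_trans (subD1set _ _))//=; apply/asboolP.
  exists (u - t *: d); split.
  - by rewrite mulmxBl -scalemxAl dG scaler0 subr0.
  - move=> j; rewrite !inE negb_or negb_and negbK !mxE => /andP[jB /orP[/eqP->|jK]].
      by rewrite /t divfK ?subrr// gt_eqF.
    by rewrite u0 ?supp_d ?mulr0 ?subr0// inE negb_or jB.
  - move=> j jA; rewrite !mxE subr_ge0.
    have [jK|jK] := boolP (j \in K); last first.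
      by rewrite supp_d ?mulr0 ?uA// inE negb_or dBA.
    have [dj|dj] := ltP 0 (d 0 j).
      by rewrite -ler_pdivlMr// kmin// /R0 jK.
    by rewrite (le_trans _ (uA _ jA))// mulr_ge0_le0.
by rewrite [X in (X <= _)%N](cardsD1 k K) kK ltnn.
Qed.

(** Ranks are bounded by [p], so some finite tuple attains the maximal rank; appending any further
    [v] cannot raise it. *)
Lemma spanning_points (F : fieldType) (T : Type) p (f : T -> 'rV[F]_p) :
  exists m (e : 'I_m -> T), forall v, (f v <= \matrix_l f (e l))%MS.
Proof.
pose P k := `[<exists m (e : 'I_m -> T), \rank (\matrix_l f (e l)) = k>].
have exP : exists k, P k.
  have e0 : 'I_0 -> T by case.
  by exists (\rank (\matrix_l f (e0 l))); apply/asboolP; exists 0%N, e0.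
have ubP k : P k -> (k <= p)%N.
  by move=> /asboolP[m [e <-]]; exact: rank_leq_col.
case: (ex_maxnP exP ubP) => k /asboolP[m [e rk]] kmax.
exists m, e => v; apply: contraT => fv.
pose e' (l : 'I_(m + 1)) := if fintype.split l is inl j then e j else v.
have eE' : \matrix_l f (e' l) = col_mx (\matrix_l f (e l)) (f v).
  apply/row_matrixP => l; rewrite rowK /e'.
  case: fintype.splitP => j /= lj.
    have -> : l = lshift 1 j by exact: val_inj.
    by rewrite rowKu rowK.
  have -> : l = rshift m j by exact: val_inj.
  by rewrite rowKd row_id.
have /kmax : P (\rank (\matrix_l f (e' l))) by apply/asboolP; exists (m + 1)%N, e'.
rewrite leqNgt -rk eE' => /negP; case.
have sub : (\matrix_l f (e l) <= col_mx (\matrix_l f (e l)) (f v))%MS.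
  by rewrite -addsmxE addsmxSl.
rewrite ltn_neqAle mxrankS// andbT.
have [_ ->] := mxrank_leqif_eq sub.
apply: contra fv => /andP[_]; apply: submx_trans.
by rewrite -addsmxE addsmxSr.
Qed.

(** * Ranks of families of functions and of their values at finitely many points *)

Section FamilyRank.
Variables (F : fieldType) (n : nat) (V : lmodType F) (v : 'I_n -> V).
Implicit Types J K : {set 'I_n}.

Lemma leq_family_rank J K :
  K \subset J -> lin_indep v K -> (#|K| <= family_rank v J)%N.
Proof.
move=> KJ vK; apply: (@leq_bigmax_cond _ _ (fun K : {set 'I_n} => #|K|)).
by rewrite KJ; exact/asboolP.
Qed.

Lemma family_rank_basis J :
  exists K : {set 'I_n}, [/\ K \subset J, lin_indep v K & #|K| = family_rank v J].
Proof.
pose P (K : {set 'I_n}) := (K \subset J) && `[<lin_indep v K>].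
have : (0 < #|P|)%N.
  apply/card_gt0P; exists finset.set0; rewrite unfold_in /P finset.sub0set/=.
  by apply/asboolP => c _ i; rewrite inE.
move=> /(eq_bigmax_cond (fun K : {set 'I_n} => #|K|))[K].
by rewrite unfold_in => /andP[KJ /asboolP vK] rK; exists K.
Qed.

End FamilyRank.

Section EvaluationRank.
Variables (F : fieldType) (T : Type) (n m : nat).
Variables (D : 'I_n -> T -> F^o) (e : 'I_m -> T).
Let G := \matrix_(i, l) D i (e l).

(** A linear relation between the functions holds in particular at the points [e l], so independent
    rows of [G] come from independent functions. *)
Lemma rank_eval_le_family_rank (J : {set 'I_n}) :
  (\rank (rowmask J *m G) <= family_rank D J)%N.
Proof.
have [K [KJ /eqP/rowmask_freeP rK /mxrankS]] := rowmask_basis J G.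
move=> /leq_trans; apply; apply: leq_trans (rank_rowmask_le _ _) _.
apply: leq_family_rank => // c cD i iK.
have /(congr1 (fun u : 'rV_n => u 0 i)) : (\row_i c i) *m rowmask K = 0.
  apply: rK; apply/rowP => l; rewrite !mxE.
  transitivity ((\sum_(i in K) c i *: D i) (e l)); last by rewrite cD.
  rewrite fct_sumE (bigID (mem K))/= [X in _ + X]big1 ?addr0 => [|j /negbTE jK].
    by apply: eq_bigr => j jK; rewrite mulmx_rowmaskE jK !mxE mul1r.
  by rewrite mulmx_rowmaskE jK !mul0r.
by rewrite mulmx_rowmaskE iK mul1r !mxE.
Qed.

(** The converse bound requires that a relation holding at the points [e l] hold everywhere. *)
Lemma family_rank_le_rank_eval (J : {set 'I_n}) :
  (forall u : 'rV[F]_n, u *m G = 0 -> forall x, \sum_i u 0 i * D i x = 0) ->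
  (family_rank D J <= \rank (rowmask J *m G))%N.
Proof.
move=> sep; have [K [KJ DK <-]] := family_rank_basis D J.
apply: leq_trans (mxrankS (rowmaskS G KJ)).
suff /eqP -> : \rank (rowmask K *m G) == #|K| by [].
apply/rowmask_freeP => u /sep uD; apply/rowP => i; rewrite mulmx_rowmaskE mxE.
have [iK|iK] := boolP (i \in K); last by rewrite mul0r.
rewrite mul1r; apply: DK iK; apply/funext => x; rewrite fct_sumE.
rewrite -[RHS](uD x) [RHS](bigID (mem K))/= [X in _ = _ + X]big1 ?addr0.
  by apply: eq_bigr => j jK; rewrite mulmx_rowmaskE jK mul1r.
by move=> j /negbTE jK; rewrite mulmx_rowmaskE jK !mul0r.
Qed.

End EvaluationRank.

(** * Limits of matrices *)

Section MatrixLimits.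
Variables (R : realFieldType).

Lemma norm_entry_le m n (M : 'M[R]_(m, n)) i j : `|M i j| <= `|M|.
Proof.
rewrite [leRHS]/Num.norm/= mx_normrE.
exact: (le_bigmax _ (fun ij : 'I_m * 'I_n => `|M ij.1 ij.2|) (i, j)).
Qed.

Lemma norm_mx_le m n (M : 'M[R]_(m, n)) a :
  0 <= a -> (forall i j, `|M i j| <= a) -> `|M| <= a.
Proof.
move=> a0 Ma; rewrite [leLHS]/Num.norm/= mx_normrE.
by apply/bigmax_leP; split=> // -[i j] _; exact: Ma.
Qed.

Lemma norm_mulmx_le m n p (M : 'M[R]_(m, n)) (N : 'M[R]_(n, p)) :
  `|M *m N| <= n%:R * (`|M| * `|N|).
Proof.
apply: norm_mx_le => [|i j]; first by rewrite !mulr_ge0.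
rewrite mxE; apply: le_trans (ler_norm_sum _ _ _) _.
apply: (@le_trans _ _ (\sum_(k < n) `|M| * `|N|)).
  by apply: ler_sum => k _; rewrite normrM ler_pM ?norm_entry_le.
by rewrite sumr_const card_ord mulr_natl.
Qed.

Lemma cvg_mx (T : Type) (F : set_system T) {FF : Filter F} m n
    (f : T -> 'M[R]_(m, n)) (M : 'M[R]_(m, n)) :
  (forall i j, f x i j @[x --> F] --> M i j) -> f x @[x --> F] --> M.
Proof.
move=> fM A [P MP PA]; apply: filterS (PA) _.
rewrite !near_simpl.
have : \forall x \near F, forall ij : 'I_m * 'I_n, P ij.1 ij.2 (f x ij.1 ij.2).
  by apply: filter_forall => -[i j]; exact/fM/MP.
by apply: filterS => x Px i j; exact: (Px (i, j)).
Qed.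

Lemma cvg_entry (T : Type) (F : set_system T) {FF : Filter F} m n
    (f : T -> 'M[R]_(m, n)) (M : 'M[R]_(m, n)) i j :
  f x @[x --> F] --> M -> f x i j @[x --> F] --> M i j.
Proof.
move=> fM; apply: (@cvg_comp _ _ _ f (fun A => A i j) _ _ _ fM).
exact: coord_continuous.
Qed.

Lemma cvg_mulmx (T : Type) (F : set_system T) {FF : Filter F} m n p
    (f : T -> 'M[R]_(m, n)) (g : T -> 'M[R]_(n, p)) (M : 'M[R]_(m, n)) (N : 'M[R]_(n, p)) :
  f x @[x --> F] --> M -> g x @[x --> F] --> N ->
  f x *m g x @[x --> F] --> M *m N.
Proof.
move=> fM gN; apply: cvg_mx => i j.
under eq_cvg => x do rewrite mxE.
rewrite mxE; apply: cvg_big => [|k _]; last by apply: cvgM; exact: cvg_entry.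
exact: add_continuous.
Qed.

End MatrixLimits.

(** * Stability of independence and of coefficients under perturbation *)

Section PerturbedIndependence.
Variables (R : realFieldType) (T : Type) (F : set_system T).
Context {FF : Filter F}.
Variables (m n : nat) (K : {set 'I_n}).
Variables (G : T -> 'M[R]_(n, m)) (G0 : 'M[R]_(n, m)) (B : 'M[R]_(m, n)).
Hypothesis GG0 : G x @[x --> F] --> G0.
Hypothesis GB : rowmask K *m G0 *m B = rowmask K.

(** On vectors supported in [K], multiplication by [G x] and then [B] is the identity plus [N x],
    and [N x] tends to 0. *)
Let N x := (G x - G0) *m B.

Let mulmx_perturb x (u : 'rV[R]_n) :
  u *m rowmask K = u -> u *m G x *m B = u + u *m N x.
Proof.
move=> uK; have uGB : u *m G0 *m B = u.
  by rewrite -[in LHS]uK -!mulmxA (mulmxA (rowmask K)) GB.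
by rewrite /N mulmxA mulmxBr mulmxBl uGB addrCA subrr addr0.
Qed.

Let cvg_N : N x @[x --> F] --> (0 : 'M[R]_n).
Proof.
rewrite -(mul0mx _ B) -(subrr G0).
by apply: cvg_mulmx; [apply: cvgB => //; exact: cvg_cst|exact: cvg_cst].
Qed.

Let cvg_nN : n%:R * `|N x| @[x --> F] --> 0.
Proof.
have : n%:R * `|N x| @[x --> F] --> n%:R * `|0 : 'M[R]_n|.
  by apply: cvgM; [exact: cvg_cst|exact: cvg_norm].
by rewrite normr0 mulr0.
Qed.

Let near_small : \forall x \near F, n%:R * `|N x| <= 2^-1.
Proof. by apply: (cvgr_le _ cvg_nN). Qed.

Let norm_half x (u : 'rV[R]_n) :
  n%:R * `|N x| <= 2^-1 -> `|u *m N x| <= 2^-1 * `|u|.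
Proof.
move=> Nx; apply: le_trans (norm_mulmx_le _ _) _.
by rewrite mulrCA mulrC ler_wpM2r.
Qed.

(** A vector [v] supported in [K] and killed by [G x] satisfies [v = - (v *m N x)], so its norm is
    at most half of itself. *)
Lemma near_rank_rowmask : \forall x \near F, \rank (rowmask K *m G x) == #|K|.
Proof.
apply: filterS near_small => x Nx; apply/rowmask_freeP => u.
set v := u *m _ => vG.
have vK : v *m rowmask K = v.
  by apply: mulmx_rowmask_id => i /negbTE iK; rewrite mulmx_rowmaskE iK mul0r.
have := mulmx_perturb x vK; rewrite vG mul0mx => /esym/eqP.
rewrite addr_eq0 => /eqP vE; apply/eqP; rewrite -normr_eq0.
have := norm_half v Nx; rewrite -normrN -vE => vle.
have := normr_ge0 v; lra.
Qed.

(** Since [u x = w x *m B - u x *m N x], it suffices that [u x] stay bounded where [N x] is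
    small. *)
Lemma cvg_rowmask_coef (w : T -> 'rV[R]_m) (u : T -> 'rV[R]_n) (w0 : 'rV[R]_m) :
  w x @[x --> F] --> w0 ->
  (forall x, u x *m rowmask K = u x) -> (forall x, u x *m G x = w x) ->
  u x @[x --> F] --> w0 *m B.
Proof.
move=> ww0 uK uG.
have uE x : u x = w x *m B - u x *m N x by rewrite -uG mulmx_perturb// addrK.
have cvg_wB : w x *m B @[x --> F] --> w0 *m B.
  by apply: cvg_mulmx => //; exact: cvg_cst.
rewrite -[w0 *m B]subr0; under eq_cvg => x do rewrite uE.
apply: cvgB => //; apply/cvgr0Pnorm_le.
have cvg_bound : 2 * `|w x *m B| * (n%:R * `|N x|) @[x --> F] --> 0.
  rewrite -(mulr0 (2 * `|w0 *m B|)); apply: cvgM; last exact: cvg_nN.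
  by apply: cvgM; [exact: cvg_cst|exact: cvg_norm].
move=> e e0; near=> x.
have small : n%:R * `|N x| <= 2^-1 by near: x; exact: near_small.
(* The term [u x *m N x] has norm at most half that of [u x] and is absorbed on the left. *)
have ub : `|u x| <= 2 * `|w x *m B|.
  have := norm_half (u x) small.
  have := ler_normB (w x *m B) (u x *m N x); rewrite -uE; lra.
apply: le_trans (norm_mulmx_le _ _) _; rewrite mulrCA.
apply: (@le_trans _ _ (2 * `|w x *m B| * (n%:R * `|N x|))).
  by rewrite ler_wpM2r// mulr_ge0.
by near: x; apply: (cvgr_le _ cvg_bound).
Unshelve. all: by end_near. Qed.

End PerturbedIndependence.

(** * Penalization *)

(** The difference quotients at a minimum are nonpositive from the left and nonnegative from the
    right. *)
Lemma is_derive_at_min (R : realFieldType) (V : normedModType R) (f : V -> R)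
    (x v : V) (df : R) :
  is_derive x v f df -> (\forall y \near x, f x <= f y) -> df = 0.
Proof.
move=> [dfx <-] fmin.
have cvg_v : (h *: v + x) @[h --> (0 : R)] --> x.
  rewrite -[X in _ --> X]add0r -(scale0r v).
  by apply: cvgD; [apply: cvgZr_tmp; exact: cvg_id|exact: cvg_cst].
have near_min : \forall h \near (0 : R), f x <= f (h *: v + x) by exact: cvg_v fmin.
pose q h := h^-1 *: (f (h *: v + x) - f x).
have cvg_q : q h @[h --> 0^'] --> 'D_v f x by exact: dfx.
apply/eqP; rewrite eq_le; apply/andP; split.
- apply: (cvgr_to_le (cvg_dnbhs_at_left cvg_q)); rewrite near_withinE.
  apply: filterS near_min => h fh h0; rewrite /q -[leLHS]/(_ * _).
  by rewrite mulr_le0_ge0 ?invr_le0 ?subr_ge0// ltW.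
- apply: (cvgr_to_ge (cvg_dnbhs_at_right cvg_q)); rewrite near_withinE.
  apply: filterS near_min => h fh h0; rewrite /q -[leRHS]/(_ * _).
  by rewrite mulr_ge0 ?invr_ge0 ?subr_ge0// ltW.
Qed.

Lemma is_derive_coord (R : realFieldType) m (s v : 'rV[R]_m) j :
  is_derive s v (fun x : 'rV[R]_m => x 0 j) (v 0 j).
Proof.
have H : (fun h : R => h^-1 *: ((h *: v + s) 0 j - s 0 j)) @ 0^' --> v 0 j.
  apply: cvg_near_cst; rewrite near_withinE; near=> h => h0.
  by rewrite !mxE addrK scalerA mulVf ?scale1r.
split; first by apply/cvg_ex; exists (v 0 j).
by apply: cvg_lim.
Unshelve. all: by end_near. Qed.

(** Otherwise the violating points, one for each [k], cluster at some [x] in [S]. If [p x = 0] this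
    contradicts the strict inequality, and if [p x] is positive a large [k] gives a
    contradiction. *)
Lemma penalty_separation (R : realType) (T : topologicalType) (S : set T)
    (q p : T -> R) (c : R) :
  compact S -> (forall s, S s -> {for s, continuous q}) ->
  (forall s, S s -> {for s, continuous p}) -> (forall s, S s -> 0 <= p s) ->
  (forall s, S s -> p s = 0 -> c < q s) ->
  exists k : nat, forall s, S s -> c < q s + k%:R * p s.
Proof.
move=> cS cq cp p0 cltq; apply: contrapT => /forallNP nok.
have bad k : exists s, S s /\ q s + k%:R * p s <= c.
  apply: contrapT => /forallNP nos; apply: (nok k) => s Ss.
  by rewrite ltNge; apply/negP => le_c; exact: (nos s).
have [s sP] := choice bad.
have [|x [Sx clx]] := cS (s @ \oo) _.
  by exists 0%N => // k _; exact: (sP k).1.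
(* With [k] fixed, every violating point of index [j >= k] also violates the inequality for [k],
   because [p] is nonnegative; continuity carries this to [x]. *)
have le_c k : q x + k%:R * p x <= c.
  rewrite leNgt; apply/negP => c_lt.
  have cvgqp : q y + k%:R * p y @[y --> x] --> q x + k%:R * p x.
    by apply: cvgD; [exact: cq|apply: cvgM; [exact: cvg_cst|exact: cp]].
  have [_ [[j /= kj <-]]] := clx (s @` [set j | (k <= j)%N]) _
    (ex_intro2 _ _ k I (fun j kj => ex_intro2 _ _ j kj erefl)) (cvgr_gt _ cvgqp _ c_lt).
  have [Sj le_j] := sP j; apply/negP; rewrite -leNgt (le_trans _ le_j)//.
  by rewrite lerD2l ler_wpM2r ?p0// ler_nat.
have [px|px] := eqVneq (p x) 0.
  by have := cltq _ Sx px; have := le_c 0%N; rewrite mul0r addr0 leNgt => /negP.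
have px0 : 0 < p x by rewrite lt_def px p0.
have := le_c (Num.trunc ((c - q x) / p x)).+1.
rewrite leNgt => /negP; apply; rewrite -ltrBlDl -ltr_pdivrMr//.
exact: truncnS_gt.
Qed.

Lemma compact_ball (R : realType) m (r : R) :
  compact [set s : 'rV[R]_m | `|s| <= r].
Proof.
apply: bounded_closed_compact.
  by exists r; split=> [|a ra s /= sr]; rewrite ?num_real ?(le_trans sr) ?ltW.
rewrite -[mkset _]/((fun s : 'rV[R]_m => `|s|) @^-1` [set a | a <= r]).
apply: closed_comp; last exact: closed_le.
by move=> s _; exact: norm_continuous.
Qed.

Lemma compact_sphere (R : realType) m (r : R) :
  compact [set s : 'rV[R]_m | `|s| = r].
Proof.
apply: (subclosed_compact _ (@compact_ball R m r)); last by move=> s /= ->.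
rewrite -[mkset _]/((fun s : 'rV[R]_m => `|s|) @^-1` [set a | a = r]).
apply: closed_comp; last exact: closed_eq.
by move=> s _; exact: norm_continuous.
Qed.

Section ApproximateKKT.
Variables (R : realType) (m n : nat) (J A : {set 'I_n}).
Variables (g0 : 'rV[R]_m -> R) (g : 'I_n -> 'rV[R]_m -> R).
Variables (G0 : 'rV[R]_m -> 'rV[R]_m) (G : 'rV[R]_m -> 'M[R]_(n, m)).
Hypothesis dJA : [disjoint J & A]%B.
Hypothesis active0 : forall i, i \in J :|: A -> g i 0 = 0.
Hypothesis near0 : \forall s \near (0 : 'rV[R]_m), [/\
  {for s, continuous g0},
  forall i, {for s, continuous (g i)},
  forall l, is_derive s (delta_mx 0 l) g0 (G0 s 0 l),
  forall i l, is_derive s (delta_mx 0 l) (g i) (G s i l) &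
  (forall i, i \in J -> g i s = 0) -> (forall i, i \in A -> g i s <= 0) ->
  g0 0 <= g0 s].

(** The violation keeps its sign on [J] and is a positive part on [A]: as multipliers are multiples
    of it, they are free on [J] and nonnegative on [A]. *)
Let viol i s := if i \in J then g i s
  else if i \in A then Num.max 0 (g i s) else 0.
(** The Euclidean square is smooth, unlike the maximum norm of matrices, and its gradient at [s] is
    [s]. *)
Let sqnorm (s : 'rV[R]_m) : R := 2^-1 * \sum_j s 0 j ^+ 2.
Let pen s := \sum_i viol i s ^+ 2.

Let viol0 i : viol i 0 = 0.
Proof.
rewrite /viol; have := @active0 i; rewrite inE.
by case: (i \in J) => [->|]//; case: (i \in A) => [->|]//; rewrite maxxx.
Qed.

(* Touching the squared violation from above at [t] by a smooth function spares
   the differentiation of [Num.max]: a minimizer [t] of the penalized objective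
   also minimizes the majorant. *)
Let viol_majorant i t s : i \in J :|: A ->
  viol i s ^+ 2 <= (viol i t - g i t + g i s) ^+ 2.
Proof.
rewrite inE /viol; case: (boolP (i \in J)) => [_ _|_ /= ->].
  by rewrite subrr add0r.
have [gt|gt] := leP 0 (g i t); first rewrite subrr add0r.
  by have [gs|gs] := leP 0 (g i s); rewrite // expr0n sqr_ge0.
have [gs|gs] := leP 0 (g i s); last by rewrite expr0n sqr_ge0.
by rewrite sub0r lerXn2r ?nnegrE//; lra.
Qed.

Let cont_viol s i : {for s, continuous (g i)} -> {for s, continuous (viol i)}.
Proof.
move=> cg; rewrite /viol; case: (i \in J) => //.
case: (i \in A); last exact: (@cst_continuous _ R).
by apply: (@continuous_max _ _ (cst 0) (g i)) => //; exact: cst_continuous.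
Qed.

Let cont_sqsum p (f : 'I_p -> 'rV[R]_m -> R) s :
  (forall i, {for s, continuous (f i)}) ->
  {for s, continuous (fun x => \sum_i f i x ^+ 2)}.
Proof.
move=> cf; apply: (@cvg_big _ _ _ _ _ _ _ (nbhs s)) => [|i _].
  exact: add_continuous.
rewrite -[X in _ --> X]/(f i s * f i s); under eq_cvg do rewrite expr2.
by apply: continuousM; exact: cf.
Qed.

Let cont_sqnorm s : {for s, continuous sqnorm}.
Proof.
apply: continuousM; first exact: cst_continuous.
by apply: cont_sqsum => j; exact: coord_continuous.
Qed.

(** The term [sqnorm] makes the minimum at 0 strict among feasible points, so a large penalty makes
    the objective exceed its value at 0 on a whole sphere. A minimizer over the ball is then
    interior, and its gradient vanishes. *)
Lemma approximate_kkt (e : R) : 0 < e -> exists (s : 'rV[R]_m) (l : 'rV[R]_n),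
  [/\ `|s| < e, G0 s + s + l *m G s = 0, (forall i, i \notin J :|: A -> l 0 i = 0)
    & (forall i, i \in A -> 0 <= l 0 i)].
Proof.
move=> e0.
have [d /= d0 dP] := nbhs_norm0P.1 near0.
pose r := Num.min e d / 2.
have r2 : 2 * r = Num.min e d by rewrite mulrC divfK.
have r0 : 0 < r by rewrite divr_gt0// lt_min e0 d0.
have re : r < e by have : 2 * r <= e by [rewrite r2 ge_min lexx]; lra.
have rd : r < d by have : 2 * r <= d by [rewrite r2 ge_min lexx orbT]; lra.
have ballP s : `|s| <= r -> _ := fun sr => dP s (le_lt_trans sr rd).
pose q s := g0 s + sqnorm s.
have cont_q s : `|s| <= r -> {for s, continuous q}.
  by move=> /ballP[cg0 _ _ _ _]; apply: continuousD => //; exact: cont_sqnorm.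
have cont_pen s : `|s| <= r -> {for s, continuous pen}.
  by move=> /ballP[_ cg _ _ _]; apply: cont_sqsum => i; exact: cont_viol.
have pen_ge0 s : 0 <= pen s by apply: sumr_ge0 => i _; exact: sqr_ge0.
have [k kP] : exists k : nat, forall s, `|s| = r -> g0 0 < q s + k%:R * pen s.
  apply: penalty_separation => //; first exact: compact_sphere.
  - by move=> s /= sr; apply: cont_q; rewrite sr.
  - by move=> s /= sr; apply: cont_pen; rewrite sr.
  (* A point of the sphere without violation is feasible, so [g0 0 <= g0 s], and [sqnorm s] is
     positive because [s] is nonzero. *)
  move=> s /= sr /eqP; rewrite psumr_eq0 => [/allP vs0|i _]; last exact: sqr_ge0.
  have {}vs0 i : viol i s = 0.
    by apply/eqP; rewrite -sqrf_eq0; apply: vs0; rewrite mem_index_enum.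
  have sr_le : `|s| <= r by rewrite sr.
  have [_ _ _ _ mins] := ballP s sr_le.
  have g0le : g0 0 <= g0 s.
    apply: mins => i iJ.
      by have := vs0 i; rewrite /viol iJ.
    by have := vs0 i; rewrite /viol iJ (disjointFl dJA iJ) => /max_idPl.
  rewrite /q (le_lt_trans g0le)// ltrDl /sqnorm mulr_gt0//.
  rewrite lt_def sumr_ge0 ?andbT => [|j _]; last exact: sqr_ge0.
  apply: contraTneq r0 => /eqP; rewrite psumr_eq0 => [/allP s0|j _]; last first.
    exact: sqr_ge0.
  rewrite -sr (_ : s = 0) ?normr0 ?ltxx//; apply/rowP => j; rewrite mxE.
  by apply/eqP; rewrite -sqrf_eq0; apply: s0; rewrite mem_index_enum.
pose f s := q s + k%:R * pen s.
have [||t tr tmin] := @compact_EVT_min _ _ f _ _ (@compact_ball R m r).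
- by exists 0; rewrite /= normr0 ltW.
- apply: continuous_in_subspaceT => s; rewrite inE => sr.
  apply: continuousD; first exact: cont_q.
  by apply: continuousM; [exact: cst_continuous|exact: cont_pen].
move: tr; rewrite inE /= => tr.
have f0 : f 0 = g0 0.
  rewrite /f /q /sqnorm /pen big1 => [|j _]; last by rewrite mxE expr0n.
  by rewrite big1 => [|i _]; rewrite ?viol0 ?expr0n// !mulr0 !addr0.
have tr_lt : `|t| < r.
  rewrite lt_neqAle tr andbT; apply/eqP => /kP; rewrite -f0 ltNge tmin//.
  by rewrite inE/= normr0 ltW.
(* The smooth majorant [Q] freezes [c i] at [t], so that [c i + g i] takes the value [viol i t]
   there; [b] drops the indices outside [J :|: A]. *)
pose b i : R := (i \in J :|: A)%:R.
pose c i : R := viol i t - g i t.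
pose Q := g0 + (2^-1 *: \sum_(j < m) (fun s : 'rV[R]_m => s 0 j) ^+ 2
  + k%:R *: \sum_(i < n) (b i *: (cst (c i) + g i) ^+ 2)).
have QE s : Q s = q s + k%:R * \sum_i b i * (c i + g i s) ^+ 2.
  by rewrite /Q /q /sqnorm !fctE !fct_sumE addrA.
have viol_out i s : i \notin J :|: A -> viol i s = 0.
  by rewrite inE /viol => /norP[/negbTE -> /negbTE ->].
have fQ s : f s <= Q s.
  rewrite QE lerD2l ler_wpM2l//; apply: ler_sum => i _.
  have [iJA|iJA] := boolP (i \in J :|: A); rewrite /b ?iJA ?(negbTE iJA) ?mul1r.
    exact: viol_majorant.
  by rewrite viol_out// expr0n mul0r.
have fQt : Q t = f t.
  rewrite QE; congr (_ + _ * _); apply: eq_bigr => i _; rewrite /c subrK.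
  have [iJA|iJA] := boolP (i \in J :|: A); rewrite /b ?iJA ?(negbTE iJA) ?mul1r//.
  by rewrite viol_out// expr0n mul0r.
have near_min : \forall s \near t, Q t <= Q s.
  near=> s; rewrite fQt (le_trans _ (fQ s))// tmin// inE/= ltW//.
  by near: s; exact: (cvgr_lt _ (@norm_continuous _ _ t)).
have [_ _ dg0 dg _] := ballP t tr.
(* These are the factors of the gradients of [g i] in the derivative of [Q] at [t]. *)
exists t, (\row_i (b i * (2 * k%:R * viol i t))); split.
- by rewrite (lt_trans tr_lt).
- apply/rowP => l; rewrite !mxE.
  have dQ : is_derive t (delta_mx 0 l) Q (G0 t 0 l +
      (2^-1 *: (\sum_(j < m) (2 * t 0 j ^+ 1) *: delta_mx (0 : 'I_1) l 0 j)
      + k%:R *: \sum_(i < n) (b i *: ((2 * (c i + g i t) ^+ 1) *: (0 + G t i l))))).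
    apply: is_deriveD.
    apply: is_deriveD.
      apply: is_deriveZ; apply: is_derive_sum => i.
      exact/(@is_deriveX _ _ _ 2)/is_derive_coord.
    apply: is_deriveZ; apply: is_derive_sum => i.
    by apply: is_deriveZ; apply: (@is_deriveX _ _ _ 2); apply: is_deriveD.
  rewrite -[RHS](is_derive_at_min dQ near_min) -addrA; congr (_ + (_ + _)).
    rewrite (bigD1 l)//= big1 => [|j jl]; last first.
      by rewrite mxE (negbTE jl) andbF scaler0.
    rewrite mxE !eqxx addr0 [X in _ *: X]mulr1 expr1.
    by rewrite [RHS]mulrA mulVf ?mul1r// pnatr_eq0.
  rewrite scaler_sumr; apply: eq_bigr => i _; rewrite !mxE /c subrK expr1 add0r.
  rewrite -[RHS]/(_ * (_ * (_ * _))); ring.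
- by move=> i /negbTE iJA; rewrite mxE /b iJA mul0r.
- move=> i iA; rewrite mxE !mulr_ge0// /viol (disjointFl dJA iA) iA.
  by rewrite le_max lexx.
Unshelve. all: by end_near. Qed.

End ApproximateKKT.

(** * The finite-dimensional problem *)

Section FiniteDimensionalKKT.
Variables (R : realType) (m n : nat) (J A : {set 'I_n}).
Variables (g0 : 'rV[R]_m -> R) (g : 'I_n -> 'rV[R]_m -> R).
Variables (G0 : 'rV[R]_m -> 'rV[R]_m) (G : 'rV[R]_m -> 'M[R]_(n, m)).
Hypothesis dJA : [disjoint J & A]%B.
Hypothesis active0 : forall i, i \in J :|: A -> g i 0 = 0.
Hypothesis near0 : \forall s \near (0 : 'rV[R]_m), [/\
  {for s, continuous g0},
  forall i, {for s, continuous (g i)},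
  forall l, is_derive s (delta_mx 0 l) g0 (G0 s 0 l),
  forall i l, is_derive s (delta_mx 0 l) (g i) (G s i l) &
  (forall i, i \in J -> g i s = 0) -> (forall i, i \in A -> g i s <= 0) ->
  g0 0 <= g0 s].
Hypothesis cont_G0 : {for 0, continuous G0}.
Hypothesis cont_G : {for 0, continuous G}.
Hypothesis const_rank : \forall s \near (0 : 'rV[R]_m),
  forall K : {set 'I_n}, J \subset K -> K \subset J :|: A ->
  \rank (rowmask K *m G s) = \rank (rowmask K *m G 0).

(** There are finitely many sets [K]: if each independent one failed for some tolerance, all would
    fail for the smallest of these tolerances. *)
Lemma independent_approximate_kkt : exists K : {set 'I_n},
  \rank (rowmask K *m G 0) = #|K| /\
  forall e, 0 < e -> exists (s : 'rV[R]_m) (l : 'rV[R]_n),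
    [/\ `|s| < e, G0 s + s + l *m G s = 0, l *m rowmask K = l,
      (forall i, i \notin J :|: A -> l 0 i = 0) &
      (forall i, i \in A -> 0 <= l 0 i)].
Proof.
have [B [BJ rB JB]] := rowmask_basis J (G 0).
have rBJ : \rank (rowmask J *m G 0) = #|B|.
  by rewrite -rB; apply/eqP; rewrite eqn_leq !mxrankS// rowmaskS.
have [C BC] := rowmask_right_inverse rB.
have near_good : \forall s \near (0 : 'rV[R]_m),
    \rank (rowmask B *m G s) == #|B| /\
    forall K : {set 'I_n}, J \subset K -> K \subset J :|: A ->
    \rank (rowmask K *m G s) = \rank (rowmask K *m G 0).
  near=> s; split; near: s; last exact: const_rank.
  exact: near_rank_rowmask cont_G BC.
have [d /= d0 dP] := nbhs_norm0P.1 near_good.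
pose good (K : {set 'I_n}) e := exists (s : 'rV[R]_m) (l : 'rV[R]_n),
  [/\ `|s| < e, G0 s + s + l *m G s = 0, l *m rowmask K = l,
    (forall i, i \notin J :|: A -> l 0 i = 0) &
    (forall i, i \in A -> 0 <= l 0 i)].
have goodW K e e' : e <= e' -> good K e -> good K e'.
  move=> ee' [s [l [se H1 H2 H3 H4]]]; exists s, l; split=> //.
  exact: lt_le_trans se ee'.
pose indep (K : {set 'I_n}) := \rank (rowmask K *m G 0) = #|K|.
have exK e : 0 < e -> exists2 K, indep K & good K e.
  move=> e0.
  have mined0 : 0 < Num.min e d by rewrite lt_min e0 d0.
  have [s [l [+ kkt l0 lA]]] := approximate_kkt dJA active0 near0 mined0.
  rewrite lt_min => /andP[se sd].
  have [/eqP rBs rKs] := dP s sd.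
  (* Constancy of the rank for [J] itself: [B] stays independent at [s] and the rank of [J] is still
     [#|B|], so [B] remains a basis. *)
  have JBs : (rowmask J *m G s <= rowmask B *m G s)%MS.
    have [_ /esym] := mxrank_leqif_eq (rowmaskS (G s) BJ).
    by rewrite rBs rKs ?finset.subsetUl// rBJ eqxx => /andP[].
  have [K [u [KA rK uG u0 uA]]] := conic_caratheodory dJA BJ JBs rBs l0 lA.
  exists (B :|: K).
    (* Independence travels from [s] to 0 by enlarging [B :|: K] to [J :|: K], where the rank is
       constant, and shrinking back. *)
    rewrite /indep (rank_rowmaskU _ BJ JB) -rK (rank_rowmaskU _ BJ JBs) rKs//.
      exact: finset.subsetUl.
    exact: finset.setUS.
  exists s, u; split=> //; first by rewrite uG.
    exact: mulmx_rowmask_id.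
  move=> i; rewrite inE => /norP[iJ iA]; apply: u0; rewrite inE negb_or.
  by rewrite (contra (fintype.subsetP BJ i) iJ) (contra (fintype.subsetP KA i) iA).
apply: contrapT => /forallNP noK.
have bad K : exists e, 0 < e /\ (indep K -> ~ good K e).
  have [iK|iK] := pselect (indep K); last by exists 1; split.
  apply: contrapT => /forallNP noe; apply: (noK K); split=> // e e0.
  by apply: contrapT => ng; apply: (noe e); split.
have [e eP] := choice bad.
pose e1 := \big[Num.min/1]_K e K.
have e10 : 0 < e1 by apply/bigmin_gtP; split=> // K _; exact: (eP K).1.
have [K iK gK] := exK _ e10.
have [_ /(_ iK)] := eP K; apply; apply: goodW gK; exact: bigmin_le.
Unshelve. all: by end_near. Qed.

(** With [K] fixed and independent at 0, the coefficients converge along points tending to 0;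
    equations and signs pass to the limit. *)
Lemma constant_rank_kkt : exists l : 'rV[R]_n,
  [/\ G0 0 + l *m G 0 = 0, (forall i, i \notin J :|: A -> l 0 i = 0) &
      (forall i, i \in A -> 0 <= l 0 i)].
Proof.
have [K [rK good]] := independent_approximate_kkt.
have [B KB] := rowmask_right_inverse rK.
have ex k : exists sl : 'rV[R]_m * 'rV[R]_n,
    [/\ `|sl.1| < k.+1%:R^-1, G0 sl.1 + sl.1 + sl.2 *m G sl.1 = 0,
      sl.2 *m rowmask K = sl.2, (forall i, i \notin J :|: A -> sl.2 0 i = 0) &
      (forall i, i \in A -> 0 <= sl.2 0 i)].
  have : 0 < k.+1%:R^-1 :> R by rewrite invr_gt0.
  by move=> /good[s [l sl]]; exists (s, l).
have [sl slP] := choice ex.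
pose s k := (sl k).1; pose l k := (sl k).2.
have s0 : s k @[k --> \oo] --> (0 : 'rV[R]_m).
  apply/cvgr0Pnorm_lt => e e0; near=> k.
  have [sk _ _ _ _] := slP k; apply: lt_trans sk _.
  by near: k; exact: near_infty_natSinv_lt (PosNum e0).
have G0s : G0 (s k) @[k --> \oo] --> G0 0 by exact: continuous_cvg cont_G0 s0.
have Gs : G (s k) @[k --> \oo] --> G 0 by exact: continuous_cvg cont_G s0.
pose w k := - (G0 (s k) + s k).
have lG k : l k *m G (s k) = w k.
  have [_ + _ _ _] := slP k; rewrite addrC => /eqP.
  by rewrite addr_eq0 => /eqP.
have w0 : w k @[k --> \oo] --> - G0 0.
  by apply: cvgN; rewrite -[G0 0]addr0; exact: cvgD.
have lB : l k @[k --> \oo] --> - G0 0 *m B.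
  by apply: (cvg_rowmask_coef Gs KB w0) lG => k; have [] := slP k.
have lBi i : l k 0 i @[k --> \oo] --> (- G0 0 *m B) 0 i by exact: cvg_entry.
exists (- G0 0 *m B); split.
(* The sequence [w] has two expressions for its limit, and their equality is stationarity. *)
- have lim_lG : w k @[k --> \oo] --> - G0 0 *m B *m G 0.
    by under eq_cvg => k do rewrite -lG; exact: cvg_mulmx.
  have -> : - G0 0 *m B *m G 0 = - G0 0 by exact: cvg_unique lim_lG w0.
  by rewrite addrN.
- move=> i iJA; apply/eqP; rewrite eq_le; apply/andP; split.
    apply: (cvgr_to_le (lBi i)); apply: nearW => k.
    by have [_ _ _ l0 _] := slP k; rewrite /l l0.
  apply: (cvgr_to_ge (lBi i)); apply: nearW => k.
  by have [_ _ _ l0 _] := slP k; rewrite /l l0.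
- move=> i iA; apply: (cvgr_to_ge (lBi i)).
  by apply: nearW => k; have [_ _ _ _] := slP k; exact.
Unshelve. all: by end_near. Qed.

End FiniteDimensionalKKT.

(** * Finite-dimensional slices *)

(** Lower semicontinuity of the rank: a basis of the selected rows of [G0] stays independent nearby,
    simultaneously for the finitely many [J]. *)
Lemma near_rank_ge (R : realFieldType) (T : Type) (F : set_system T)
    {FF : Filter F} m n (G : T -> 'M[R]_(n, m)) (G0 : 'M[R]_(n, m)) :
  G x @[x --> F] --> G0 ->
  \forall x \near F, forall J, (\rank (rowmask J *m G0) <= \rank (rowmask J *m G x))%N.
Proof.
move=> GG0; apply: filter_forall => J.
have [K [KJ rK JK]] := rowmask_basis J G0.
have [B KB] := rowmask_right_inverse rK.
apply: filterS (near_rank_rowmask GG0 KB) => x /eqP rKx.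
by rewrite (leq_trans (mxrankS JK))// rK -rKx mxrankS// rowmaskS.
Qed.

Lemma is_derive_affine (R : realFieldType) (V W : normedModType R) (phi : V -> W)
    (f : W -> R) (s v : V) (w : W) (df : R) :
  (forall k : R, phi (k *: v + s) = k *: w + phi s) ->
  is_derive (phi s) w f df -> is_derive s v (f \o phi) df.
Proof.
move=> phiE [dfw <-].
have E : (fun k : R => k^-1 *: ((f \o phi \o shift s) (k *: v) - (f \o phi) s)) =
         (fun k : R => k^-1 *: ((f \o shift (phi s)) (k *: w) - f (phi s))).
  by apply/funext => k /=; rewrite phiE.
by split; rewrite /derivable /derive E.
Qed.

Lemma is_derive_diff (R : realFieldType) (V : normedModType R) (f : V -> R) (x v : V) :
  differentiable f x -> is_derive x v f ('d f x v).
Proof.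
by move=> dfx; rewrite -deriveE//; apply/derivableP/diff_derivable.
Qed.

Lemma C1_near_differentiable (R : realType) (E : normedModType R) (f : E -> R) (x : E) :
  C1_near f x -> \forall y \near x, differentiable f y.
Proof. by apply: filterS => y []. Qed.

Lemma C1_near_cvg_diff (R : realType) (E : normedModType R) (f : E -> R) (x v : E) :
  C1_near f x -> 'd f y v @[y --> x] --> 'd f x v.
Proof.
move=> /nbhs_singleton[_ cdf]; apply/cvgrPdist_le => e e0.
(* Adding 1 keeps the divisor positive when [v = 0]. *)
have v1 : 0 < `|v| + 1 by rewrite ltr_wpDl.
have /cdf : 0 < e / (`|v| + 1) by rewrite divr_gt0.
apply: filterS => y /(_ v); rewrite distrC => /le_trans; apply.
by rewrite mulrAC ler_pdivrMr// ler_wpM2l ?lerDl// ltW.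
Qed.

Section Slice.
Variables (R : realType) (E : normedModType R) (m : nat) (x0 : E) (e : 'I_m -> E).

Definition slice (s : 'rV[R]_m) : E := \sum_l s 0 l *: e l + x0.

Lemma slice0 : slice 0 = x0.
Proof. by rewrite /slice big1 ?add0r// => l _; rewrite mxE scale0r. Qed.

Lemma slice_direction s l (k : R) :
  slice (k *: delta_mx 0 l + s) = k *: e l + slice s.
Proof.
rewrite /slice addrA; congr (_ + _).
rewrite (eq_bigr (fun j => (k * (j == l)%:R) *: e j + s 0 j *: e j)) => [|j _].
  rewrite big_split/=; congr (_ + _); rewrite (bigD1 l)//= big1 ?addr0 => [|j].
    by rewrite eqxx mulr1.
  by move=> /negbTE ->; rewrite mulr0 scale0r.
by rewrite !mxE eqxx/= scalerDl.
Qed.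

Lemma slice_continuous : continuous slice.
Proof.
move=> s; apply: continuousD; last exact: cst_continuous.
apply: (@cvg_big _ _ _ _ _ _ _ (nbhs s)) => [|l _]; first exact: add_continuous.
by apply: cvgZr_tmp; exact: coord_continuous.
Qed.

End Slice.

Lemma stationary_lagrangian (R : realType) (E : normedModType R) n
    (h0 : E -> R) (h : 'I_n -> E -> R) (x : E) (l : 'rV[R]_n) :
  differentiable h0 x -> (forall i, differentiable (h i) x) ->
  (forall v, 'd h0 x v + \sum_i l 0 i * 'd (h i) x v = 0) ->
  is_diff x (lagrangian h0 h l) (0 : E -> R).
Proof.
move=> dh0 dh stat.
have LE : lagrangian h0 h l = h0 + \sum_(i < n) (l 0 i *: h i).
  by apply/funext => y; rewrite /lagrangian !fctE fct_sumE.
have dL : differentiable (lagrangian h0 h l) x.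
  rewrite LE; apply: differentiableD => //; apply: differentiable_sum => i.
  exact: differentiableZ.
apply: DiffDef => //; apply/funext => v.
rewrite -deriveE// -[RHS](stat v) LE.
have D0 := is_derive_diff v dh0.
have Di i := is_derive_diff v (dh i).
exact: derive_val.
Qed.

(** * From the slice back to the Banach space *)

Unset Implicit Arguments.
Set Strict Implicit.

Theorem proposition7p1 (R : realType) (E : completeNormedModType R) (n : nat)
    (I0 I : {set 'I_n}) (h0 : E -> R) (h : 'I_n -> E -> R) (x0 : E)
    (disjI : [disjoint I0 & I]%B) (coverI : (I0 :|: I)%SET = [set: 'I_n]%SET)
    (hmin : local_minimum h0 (feasible I0 I h) x0)
    (C1_h0 : C1_near h0 x0) (C1_h : forall i, C1_near (h i) x0)
    (rcrcq : RCRCQ I0 I h x0) :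
  multipliers I h0 h x0 !=set0.
Proof.
pose A := active I h x0.
have AI : A \subset I by apply/fintype.subsetP => i; rewrite inE => /andP[].
have dI0A : [disjoint I0 & A]%B by exact: disjointWr AI disjI.
have [[feas0 feasI] min0] := hmin.
have dh0 : differentiable h0 x0 by have /nbhs_singleton[] := C1_h0.
have dh i : differentiable (h i) x0 by have /nbhs_singleton[] := C1_h i.
(* All derivatives in the direction [v], gathered in one row: every such row is a combination of
   those for the [e l]. *)
pose f v : 'rV[R]_(1 + n) := row_mx ('d h0 x0 v)%:M (\row_i 'd (h i) x0 v).
have [m [e span_e]] := spanning_points f.
pose phi := slice x0 e.
have phi0 : phi 0 = x0 by exact: slice0.
have phi_cvg : phi s @[s --> (0 : 'rV[R]_m)] --> x0.
  by rewrite -[X in _ --> X]phi0; exact: slice_continuous.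
have near_phi (P : set E) : nbhs x0 P -> \forall s \near (0 : 'rV[R]_m), P (phi s).
  by move=> Px0; exact: phi_cvg Px0.
pose G0 s : 'rV[R]_m := \row_l 'd h0 (phi s) (e l).
pose G s : 'M[R]_(n, m) := \matrix_(i, l) 'd (h i) (phi s) (e l).
(* The case [a = 0] compares ranks on the slice with ranks in the dual; the case [a = 1] lifts the
   multiplier. *)
have separating (a : R) (u : 'rV[R]_n) : a *: G0 0 + u *m G 0 = 0 ->
    forall v, a * 'd h0 x0 v + \sum_i u 0 i * 'd (h i) x0 v = 0.
  move=> auG v; have /submxP[X fX] := span_e v.
  have fE w : (f w *m (row_mx a%:M u)^T) 0 0 =
      a * 'd h0 x0 w + \sum_i u 0 i * 'd (h i) x0 w.
    rewrite tr_row_mx mul_row_col mxE tr_scalar_mx mul_scalar_mx !mxE mulr1n mulrC.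
    by congr (_ + _); apply: eq_bigr => i _; rewrite !mxE mulrC.
  rewrite -fE fX -mulmxA (_ : _ *m _^T = 0) ?mulmx0 ?mxE//.
  apply/row_matrixP => l; rewrite row_mul rowK row0; apply/rowP => j.
  have auGl : (a *: G0 0 + u *m G 0) 0 l = 0 by rewrite auG mxE.
  rewrite ord1 fE [RHS]mxE -[RHS]auGl !mxE phi0.
  by congr (_ + _); apply: eq_bigr => i _; rewrite mxE phi0.
have cont_G : {for 0, continuous G}.
  apply: (@cvg_mx _ _ (nbhs (0 : 'rV[R]_m))) => i l.
  under eq_cvg => s do rewrite mxE; rewrite mxE phi0.
  exact: cvg_comp phi_cvg (C1_near_cvg_diff (C1_h i)).
have cont_G0 : {for 0, continuous G0}.
  apply: (@cvg_mx _ _ (nbhs (0 : 'rV[R]_m))) => i l.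
  under eq_cvg => s do rewrite mxE; rewrite mxE phi0.
  exact: cvg_comp phi_cvg (C1_near_cvg_diff C1_h0).
have near0 : \forall s \near (0 : 'rV[R]_m), [/\
    {for s, continuous (h0 \o phi)},
    forall i, {for s, continuous (h i \o phi)},
    forall l, is_derive s (delta_mx 0 l) (h0 \o phi) (G0 s 0 l),
    forall i l, is_derive s (delta_mx 0 l) (h i \o phi) (G s i l) &
    (forall i, i \in I0 -> (h i \o phi) s = 0) ->
    (forall i, i \in A -> (h i \o phi) s <= 0) -> (h0 \o phi) 0 <= (h0 \o phi) s].
  have near_dh0 : \forall s \near (0 : 'rV[R]_m), differentiable h0 (phi s).
    exact: (near_phi _ (C1_near_differentiable C1_h0)).
  have near_dh : \forall s \near (0 : 'rV[R]_m), forall i, differentiable (h i) (phi s).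
    apply: (@filter_forall _ _ _ (nbhs (0 : 'rV[R]_m))) => i.
    exact: (near_phi _ (C1_near_differentiable (C1_h i))).
  (* Inactive inequalities are strict at [x0] and persist nearby, so feasibility on the slice
     reduces to [I0] and [A]. *)
  have near_inactive : \forall s \near (0 : 'rV[R]_m),
      forall i, i \in I :\: A -> h i (phi s) <= 0.
    apply: (@filter_forall _ _ _ (nbhs (0 : 'rV[R]_m))) => i.
    have [iIA|/negP iIA] := boolP (i \in I :\: A); last exact: nearW.
    have hi0 : h i x0 < 0.
      move: iIA; rewrite !inE => /andP[+ iI]; rewrite iI /= => hi0.
      by rewrite lt_neqAle hi0 feasI.
    near=> s => _; near: s.
    exact: (cvgr_le _ (cvg_comp _ _ phi_cvg (differentiable_continuous (dh i))) _ hi0).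
  near=> s.
  have dh0s : differentiable h0 (phi s) by near: s.
  have dhs : forall i, differentiable (h i) (phi s) by near: s.
  split.
  - apply: continuous_comp; first exact: slice_continuous.
    exact: differentiable_continuous.
  - move=> i; apply: continuous_comp; first exact: slice_continuous.
    exact: differentiable_continuous.
  - move=> l; rewrite mxE; apply: is_derive_affine (is_derive_diff _ dh0s) => k.
    exact: slice_direction.
  - move=> i l; rewrite mxE; apply: is_derive_affine (is_derive_diff _ (dhs i)) => k.
    exact: slice_direction.
  - rewrite /= phi0 => hI0 hA.
    have : feasible I0 I h (phi s) -> h0 x0 <= h0 (phi s).
      by near: s; exact: (near_phi _ min0).
    apply; split=> // i iI; have [iA|iA] := boolP (i \in A); first exact: hA.
    have := iI; have : i \in I :\: A by rewrite inE iA.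
    by move=> iIA _; move: i {iI iA} iIA; near: s.
have active0 i : i \in I0 :|: A -> (h i \o phi) 0 = 0.
  by rewrite inE /= phi0 => /orP[/feas0//|]; rewrite inE => /andP[_ /eqP].
have const_rank : \forall s \near (0 : 'rV[R]_m),
    forall K : {set 'I_n}, I0 \subset K -> K \subset I0 :|: A ->
    \rank (rowmask K *m G s) = \rank (rowmask K *m G 0).
  have [U Ux0 rankU] := rcrcq.
  have near_U := near_phi _ Ux0.
  (* The rank at [s] is at most the rank in the dual at [phi s], which equals the one at [x0] by
     RCRCQ, itself at most the rank at 0; semicontinuity gives the reverse inequality. *)
  near=> s => K I0K KA; apply/eqP; rewrite eqn_leq.
  have ge : forall K : {set 'I_n},
      (\rank (rowmask K *m G 0%R) <= \rank (rowmask K *m G s))%N.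
    by near: s; exact: near_rank_ge.
  rewrite ge andbT.
  apply: (leq_trans (rank_eval_le_family_rank
    (fun i => 'd (h i) (phi s) : E -> R^o) e K)).
  rewrite -[leqLHS]/(diff_rank h K (phi s)) rankU//; last by near: s.
  have G0E : G 0 = \matrix_(i, l) 'd (h i) x0 (e l).
    by apply/matrixP => i l; rewrite !mxE phi0.
  rewrite G0E; apply: (@family_rank_le_rank_eval _ _ _ _
    (fun i => 'd (h i) x0 : E -> R^o) e) => u uG x.
  have := @separating 0 u; rewrite scale0r add0r G0E => /(_ uG x).
  by rewrite mul0r add0r.
have [l [stat l0 lA]] := constant_rank_kkt dI0A active0 near0 cont_G0 cont_G const_rank.
exists l; split.
  apply: stationary_lagrangian => // v.
  by have := @separating 1 l; rewrite scale1r => /(_ stat v); rewrite mul1r.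
(* Complementarity: [h i x0] vanishes when [i] is active, and [l 0 i] vanishes otherwise. *)
move=> i iI; have [iA|iA] := boolP (i \in A).
  by split; [exact: lA|move: iA; rewrite inE => /andP[_ /eqP ->]; rewrite mulr0].
by rewrite l0 ?mul0r// inE negb_or iA andbT (disjointFl disjI iI).
Unshelve. all: by end_near. Qed.
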